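(* Let $A>1$ be an odd number and let $a_i$ denote the sequence of odd numbers in the Collatz sequence of $A$, with $a_0=A$. Construct a sequence $b_i$ as follows. Let $$b_0=\begin{cases}12\left(2^4\left(\frac{A}{3}\right)+1\right)+9 & \text{if } A\equiv 0 \bmod 3,\\[2pt] 12\left(\frac{4A-1}{3}\right)+9 & \text{if } A\equiv 1 \bmod 3,\\[2pt] 12\left(\frac{2A-1}{3}\right)+9 & \text{if } A\equiv 2 \bmod 3.\end{cases}$$ If for any $i$, $a_i=1$, then $b_i=12\times 1+9=21$. Let $i\ge 1$ and let $a_{i-1}>1$. - If $a_{i-1}\equiv 3 \bmod 4$, let $b_i=12\left(\frac{a_{i-1}-1}{2}\right)+9$. - If $a_{i-1}\equiv 1\bmod 4$, then $a_{i-1}=2^kN+1$ for some odd number $N$ and $k\ge 2$. If $k>2$, let $b_i=12a_{i-1}+9$. If $k=2$, then $a_{i-1}$ is a jump from an odd number $P$ such that $P$ is not a jump from an odd number. If $P=1$, let $b_i=12\times 1+9=21$. If $P>1$, write $P=2^rq+1$ such that $q$ is an odd number. Then $r\neq 2$. If $r=1$, let $b_i=12\left(\frac{P-1}{2}\right)+9$; otherwise, let $b_i=12P+9$. Then, for all $i\ge 0$: 1. $b_i$ is odd, $b_i$ is divisible by $3$, and $b_i\equiv 9\bmod 12$. 2. The Collatz sequences of $a_i$ and $b_i$ are equivalent. 3. If $a_i>1$, write $a_i=2^kn_i+1$ such that $k\ge 1$ and $n_i$ is an odd number. If $k\neq 2$, then $$b_{i+1}=\begin{cases}3(2a_i+1)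 & \text{if } k=1,\\ 3(4a_i+3) & \text{otherwise.}\end{cases}$$ If $k=2$, then $a_i$ is a jump from an odd number $j_i$ such that $j_i$ is not a jump from an odd number. If $j_i>1$, write $j_i=2^rq_i+1$ such that $r\ge 1$ and $q_i$ is an odd number. Then $r\neq 2$, and $$b_{i+1}=\begin{cases}3(2j_i+1) & \text{if } r=1,\\ 3(4j_i+3) & \text{otherwise.}\end{cases}$$
   Context: The Collatz sequence of a positive integer $A$ is $c_0=A$, and for $i\ge1$, $c_i=3c_{i-1}+1$ if $c_{i-1}$ is odd and $c_i=c_{i-1}/2$ if $c_{i-1}$ is even. The sequence of odd numbers in the Collatz sequence is the subsequence of its odd terms in order, indexed from $0$; for $A$ odd its $0$-th term is $A$. The odd term $1$ is followed by $1,1,1,\dots$. Two Collatz sequences (of odd starting numbers) are equivalent if the second odd number occurring in each sequence is the same, i.e. the odd terms with index $1$ coincide. An integer $A$ is a jump from an integer $P$ of height $d\ge1$ if $A=4^dP+4^{d-1}+4^{d-2}+\cdots+4+1$; $A$ is a jump from $P$ if this holds for some $d\ge 1$.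
   Formalization: For A ≡ 2 mod 3, b_0 is taken to be 12(((2A-1)/3 - 1)/2)+9 = 4A+1 instead of the printed 12((2A-1)/3)+9 = 8A+5, with which claim 2 fails at i = 0 (A = 5 gives b_0 = 45, with second odd term 17 instead of 1). *)

(* Defs.v *)
From Stdlib Require Export ZArith List Lia.
Open Scope Z_scope.

Definition collatz_step (c : Z) : Z :=
  if Z.odd c then 3 * c + 1 else c / 2.

Definition collatz (A : Z) (i : nat) : Z := Nat.iter i collatz_step A.

(** [a] is the subsequence of the odd terms of the Collatz sequence of [A]:
    [t] enumerates in increasing order exactly the indices of the odd terms.
    Since 1 -> 4 -> 2 -> 1, an odd term 1 is followed by 1, 1, 1, ... *)
Definition odd_terms (A : Z) (a : nat -> Z) : Prop :=
  exists t : nat -> nat,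
    (forall i, (t i < t (S i))%nat) /\
    (forall n, Z.Odd (collatz A n) <-> exists i, t i = n) /\
    (forall i, a i = collatz A (t i)).

Definition collatz_equiv (A B : Z) : Prop :=
  exists a b : nat -> Z, odd_terms A a /\ odd_terms B b /\ a 1%nat = b 1%nat.

Definition zsum (l : list Z) : Z := fold_right Z.add 0 l.

Definition jump_of_height (d : nat) (A P : Z) : Prop :=
  (1 <= d)%nat /\
  A = 4 ^ Z.of_nat d * P + zsum (map (fun j => 4 ^ Z.of_nat j) (seq 0 d)).

(** [jump A P]: [A] is a jump from [P]. *)
Definition jump (A P : Z) : Prop := exists d : nat, jump_of_height d A P.

Definition jump_from_odd (A : Z) : Prop := exists P : Z, Z.Odd P /\ jump A P.

(** All divisions are exact for odd [A].  In the last case [p = (2A-1)/3] is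
    the integer with [3p+1 = 2A]; it is 3 modulo 4, and the value
    [12((p-1)/2)+9] is the one [companion_step] below assigns to such a term.
    The variant [12p+9] would not do: for [A = 5] it is 45, whose next odd
    term is 17, whereas the next odd term of 5 is 1. *)
Definition companion_init (A : Z) : Z :=
  if A mod 3 =? 0 then 12 * (2 ^ 4 * (A / 3) + 1) + 9
  else if A mod 3 =? 1 then 12 * ((4 * A - 1) / 3) + 9
  else 12 * (((2 * A - 1) / 3 - 1) / 2) + 9.

(** Constraint on the term [y] = b_i in terms of [x] = a_{i-1} > 1. *)
Definition companion_step (x y : Z) : Prop :=
  (x mod 4 = 3 -> y = 12 * ((x - 1) / 2) + 9) /\
  (x mod 4 = 1 ->
   forall (k : nat) (N : Z),
     (2 <= k)%nat -> Z.Odd N -> x = 2 ^ Z.of_nat k * N + 1 ->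
     ((2 < k)%nat -> y = 12 * x + 9) /\
     (k = 2%nat ->
      forall P : Z, Z.Odd P -> jump x P -> ~ jump_from_odd P ->
        (P = 1 -> y = 12 * 1 + 9) /\
        (1 < P ->
         forall (r : nat) (q : Z), Z.Odd q -> P = 2 ^ Z.of_nat r * q + 1 ->
           (r = 1%nat -> y = 12 * ((P - 1) / 2) + 9) /\
           (r <> 1%nat -> y = 12 * P + 9)))).

Definition companion (A : Z) (a b : nat -> Z) : Prop :=
  b 0%nat = companion_init A /\
  (forall i : nat, a i = 1 -> b i = 12 * 1 + 9) /\
  (forall i : nat, (1 <= i)%nat -> 1 < a (i - 1)%nat ->
     companion_step (a (i - 1)%nat) (b i)).

Lemma collatz_S A n : collatz A (S n) = collatz_step (collatz A n).
Proof. reflexivity. Qed.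

Lemma collatz_pos A n : 0 < A -> 0 < collatz A n.
Proof.
intros HA; induction n as [|n IH]; [exact HA|].
rewrite collatz_S; unfold collatz_step.
destruct (Z.odd (collatz A n)) eqn:E; [lia|].
assert (Hm := Zodd_mod (collatz A n)); rewrite E in Hm.
assert (collatz A n mod 2 <> 1) by (intros H; rewrite H in Hm; discriminate).
assert (H2 := Z.div_mod (collatz A n) 2 ltac:(lia)).
assert (0 <= collatz A n mod 2 < 2) by (apply Z.mod_pos_bound; lia).
lia.
Qed.

Lemma next_odd_index A (HA : 0 < A) (n : nat) :
  {m : nat | (n <= m)%nat /\ Z.odd (collatz A m) = true /\
     forall j, (n <= j < m)%nat -> Z.odd (collatz A j) = false}.
Proof.
remember (Z.to_nat (collatz A n)) as s eqn:Hs.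
revert n Hs; induction s as [s IH] using (well_founded_induction Wf_nat.lt_wf).
intros n Hs; destruct (Z.odd (collatz A n)) eqn:E.
- exists n; repeat split; [lia|exact E|intros j Hj; lia].
- assert (Hlt : (Z.to_nat (collatz A (S n)) < s)%nat).
  { assert (Hp := collatz_pos A n HA).
    rewrite collatz_S; unfold collatz_step; rewrite E.
    assert (collatz A n / 2 < collatz A n) by (apply Z.div_lt; lia).
    lia. }
  destruct (IH _ Hlt (S n) eq_refl) as (m & H1 & H2 & H3).
  exists m; repeat split; [lia|exact H2|].
  intros j Hj; destruct (Nat.eq_dec j n) as [->|]; [exact E|apply H3; lia].
Qed.

Lemma odd_terms_exist A : 0 < A -> exists a, odd_terms A a.
Proof.
intros HA.
set (g := fun n => proj1_sig (next_odd_index A HA n)).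
assert (Hg : forall n, (n <= g n)%nat /\ Z.odd (collatz A (g n)) = true /\
   forall j, (n <= j < g n)%nat -> Z.odd (collatz A j) = false)
  by (intros n; exact (proj2_sig (next_odd_index A HA n))).
set (t := fun i => Nat.iter i (fun n => g (S n)) (g 0%nat)).
exists (fun i => collatz A (t i)), t; split; [|split; [|reflexivity]].
- intros i; change (t (S i)) with (g (S (t i))).
  destruct (Hg (S (t i))); lia.
- intros n; split.
  + intros Ho; apply Z.odd_spec in Ho.
    assert (Hk : forall k, (n < t k)%nat -> exists i, t i = n).
    { induction k as [|k IH]; intros Hlt.
      - destruct (Hg 0%nat) as (_ & _ & H).
        rewrite (H n) in Ho; [discriminate|].
        change (t 0%nat) with (g 0%nat) in Hlt; lia.
      - destruct (lt_eq_lt_dec n (t k)) as [[H|H]|H]; [auto|eauto|].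
        destruct (Hg (S (t k))) as (_ & _ & H').
        rewrite (H' n) in Ho; [discriminate|].
        change (t (S k)) with (g (S (t k))) in Hlt; lia. }
    apply (Hk (S n)).
    assert (Hge : forall k, (k <= t k)%nat).
    { induction k as [|k IH]; [lia|].
      change (t (S k)) with (g (S (t k))); destruct (Hg (S (t k))); lia. }
    specialize (Hge (S n)); lia.
  + intros [i <-]; apply Z.odd_spec; destruct i as [|i].
    * apply (Hg 0%nat).
    * apply (Hg (S (t i))).
Qed.

(* Main.v *)
(** A jump [x] from [P] of height [d] satisfies [3x+1 = 4^d (3P+1)], so [x] and [P] have
    the same next odd term [z].  For [a] odd, [companion_init a] is a jump from [a] of height
    3, 2 or 1.  In fact [b_i = companion_init a_i] for all [i]: the recursive formulas for
    [b_(i+1)] agree with this because [z = (3P+1)/2] is 2 mod 3 when [P] is 3 mod 4, and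
    [z = (3P+1)/4] is 1 mod 3 when [P] is 1 mod 8; the remaining odd numbers, those equal
    to 5 mod 8, are exactly the jumps from odd numbers. *)

Require Import Defs.

(** * Odd parts of integers and the next odd term *)

Ltac div_lia := Z.to_euclidean_division_equations; lia.

(** Says that [z] is the odd part of [3x+1], which for odd [x] is the odd Collatz term after [x].
    This form involves no Collatz indices, so the arithmetic can be done separately from the
    sequences. *)
Definition next_odd (x z : Z) : Prop :=
  Z.Odd z /\ exists m : nat, 3 * x + 1 = 2 ^ Z.of_nat m * z.

Lemma pow_succ_nat (c : Z) (n : nat) : c ^ Z.of_nat (S n) = c * c ^ Z.of_nat n.
Proof. rewrite Nat2Z.inj_succ, Z.pow_succ_r; lia. Qed.

Lemma odd_mod_2 (x : Z) : Z.Odd x <-> x mod 2 = 1.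
Proof.
split; [intros [k ->]; div_lia|].
intros H; exists (x / 2); div_lia.
Qed.

Lemma odd_part_unique (m m' : nat) (z z' : Z) :
  Z.Odd z -> Z.Odd z' -> 2 ^ Z.of_nat m * z = 2 ^ Z.of_nat m' * z' -> z = z'.
Proof.
rewrite !odd_mod_2; revert m'.
induction m as [|m IH]; intros [|m'] Hz Hz' E; rewrite ?pow_succ_nat in E;
  change (2 ^ Z.of_nat 0) with 1 in E; try div_lia.
apply (IH m'); div_lia.
Qed.

Lemma odd_part_exists (x : Z) :
  x <> 0 -> exists (k : nat) (n : Z), Z.Odd n /\ x = 2 ^ Z.of_nat k * n.
Proof.
remember (Z.abs_nat x) as s eqn:Hs; revert x Hs.
induction s as [s IH] using (well_founded_induction Wf_nat.lt_wf); intros x Hs Hx.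
destruct (Z.eq_dec (x mod 2) 1) as [Ho|He].
- exists 0%nat, x; split; [now apply odd_mod_2|].
  change (2 ^ Z.of_nat 0) with 1; div_lia.
- destruct (IH (Z.abs_nat (x / 2)) ltac:(div_lia) (x / 2) eq_refl ltac:(div_lia))
    as (k & n & Hn & E).
  exists (S k), n; split; [exact Hn|].
  rewrite pow_succ_nat; div_lia.
Qed.

(** Turns every case distinction on the exponent [k] into a congruence: [2N+1], [4N+1] and [8M+1]
    with [N] odd are 3 mod 4, 5 mod 8 and 1 mod 8, while [k = 0] would make [x] even. *)
Lemma odd_part_pred_cases (x N : Z) (k : nat) :
  Z.Odd x -> Z.Odd N -> x = 2 ^ Z.of_nat k * N + 1 ->
  (k = 1%nat /\ x mod 4 = 3) \/ (k = 2%nat /\ x mod 8 = 5) \/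
  ((2 < k)%nat /\ x mod 8 = 1).
Proof.
rewrite !odd_mod_2; intros Hx HN E.
destruct k as [|[|[|k]]]; rewrite ?pow_succ_nat in E;
  [change (2 ^ Z.of_nat 0) with 1 in E; div_lia
  |left; change (2 ^ Z.of_nat 0) with 1 in E; div_lia
  |right; left; change (2 ^ Z.of_nat 0) with 1 in E; div_lia|].
right; right; split; [div_lia|].
replace x with (1 + (2 ^ Z.of_nat k * N) * 8) by div_lia.
now rewrite Z.mod_add.
Qed.

Lemma next_odd_unique (x z z' : Z) : next_odd x z -> next_odd x z' -> z = z'.
Proof.
intros (Hz & m & E) (Hz' & m' & E').
apply (odd_part_unique m m'); [assumption..|congruence].
Qed.

(** * Jumps between integers and their roots *)

Lemma geometric_sum_4 (d : nat) :
  3 * zsum (map (fun j => 4 ^ Z.of_nat j) (seq 0 d)) + 1 = 4 ^ Z.of_nat d.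
Proof.
assert (Happ : forall l y, zsum (l ++ y :: nil) = zsum l + y).
{ induction l as [|u l IH]; intros y; simpl; [lia|].
  unfold zsum in *; simpl; rewrite IH; lia. }
induction d as [|d IH]; [reflexivity|].
rewrite seq_S, map_app; cbn [map]; rewrite Happ, Nat.add_0_l, pow_succ_nat; lia.
Qed.

(** Tripling and adding 1 absorbs the geometric sum, so a jump just multiplies [3P+1] by a power of
    4. *)
Lemma jump_iff (A P : Z) :
  jump A P <->
  exists d : nat, (1 <= d)%nat /\ 3 * A + 1 = 4 ^ Z.of_nat d * (3 * P + 1).
Proof.
split; intros (d & Hd & E); exists d; (split; [exact Hd|]);
  assert (G := geometric_sum_4 d); lia.
Qed.

Lemma jump_trans (A B C : Z) : jump A B -> jump B C -> jump A C.
Proof.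
rewrite !jump_iff; intros (d & Hd & E) (e & He & F).
exists (d + e)%nat; split; [lia|].
rewrite Nat2Z.inj_add, Z.pow_add_r, E, F by lia; lia.
Qed.

(** For [P] odd, [3P+1] is even, so 8 divides [3A+1], which means that [A] is 5 mod 8. Conversely,
    [8m+5 = 4(2m+1)+1] is a jump of height 1 from [2m+1]. *)
Lemma jump_from_odd_iff (A : Z) : jump_from_odd A <-> A mod 8 = 5.
Proof.
split.
- intros (P & HP & HJ); rewrite jump_iff in HJ; destruct HJ as ([|d] & Hd & E); [div_lia|].
  destruct HP as [c ->]; rewrite pow_succ_nat in E.
  assert (3 * A + 1 = 8 * (4 ^ Z.of_nat d * (3 * c + 2))) by div_lia.
  div_lia.
- intros H; exists (A / 4); split; [apply odd_mod_2; div_lia|].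
  apply jump_iff; exists 1%nat; split; [div_lia|].
  change (4 ^ Z.of_nat 1) with 4; div_lia.
Qed.

Lemma jump_pos (A P : Z) : 0 < A -> Z.Odd P -> jump A P -> 1 <= P.
Proof.
intros HA HP HJ; apply jump_iff in HJ as (d & _ & E).
assert (0 < 4 ^ Z.of_nat d) by div_lia.
assert (0 < 3 * P + 1) by nia.
apply odd_mod_2 in HP; div_lia.
Qed.

(** Descent: as long as the number is 5 mod 8, undo a jump of height 1 by passing from [x] to
    [x / 4], that is [(x-1)/4], which is smaller. *)
Lemma jump_root_exists (x : Z) :
  0 < x -> x mod 8 = 5 -> exists P, Z.Odd P /\ jump x P /\ ~ jump_from_odd P.
Proof.
remember (Z.to_nat x) as s eqn:Hs; revert x Hs.
induction s as [s IH] using (well_founded_induction Wf_nat.lt_wf); intros x Hs Hx H5.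
assert (HJ : jump x (x / 4)).
{ apply jump_iff; exists 1%nat; split; [div_lia|].
  change (4 ^ Z.of_nat 1) with 4; div_lia. }
destruct (Z.eq_dec ((x / 4) mod 8) 5) as [H|H].
- destruct (IH (Z.to_nat (x / 4)) ltac:(div_lia) (x / 4) eq_refl ltac:(div_lia) H)
    as (P & HP & HJ' & HN).
  exists P; split; [exact HP|split; [|exact HN]].
  exact (jump_trans _ _ _ HJ HJ').
- exists (x / 4); split; [apply odd_mod_2; div_lia|split; [exact HJ|]].
  now rewrite jump_from_odd_iff.
Qed.

Lemma next_odd_jump (A P z : Z) : jump A P -> (next_odd A z <-> next_odd P z).
Proof.
intros HJ; apply jump_iff in HJ as (d & _ & E).
assert (Hd : 4 ^ Z.of_nat d = 2 ^ Z.of_nat (2 * d)).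
{ rewrite Nat2Z.inj_mul, Z.pow_mul_r by lia; reflexivity. }
split; intros (Hz & m & F); split; try exact Hz.
(* Rather than cancelling [4^d] against [2^m], take the odd part of [3P+1] and identify it with [z]
   by uniqueness. *)
- destruct (odd_part_exists (3 * P + 1) ltac:(lia)) as (k & n & Hn & G).
  exists k.
  replace z with n; [exact G|].
  apply (odd_part_unique (2 * d + k) m); [assumption..|].
  rewrite <- F, E, G, Hd, Nat2Z.inj_add, Z.pow_add_r; lia.
- exists (2 * d + m)%nat.
  rewrite E, F, Hd, Nat2Z.inj_add, Z.pow_add_r; lia.
Qed.

(** * Values of [companion_init] and of the recursive clauses *)

Lemma companion_init_jump (x : Z) : Z.Odd x -> jump (companion_init x) x.
Proof.
rewrite odd_mod_2; intros Hx; apply jump_iff; unfold companion_init.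
(* The three branches simplify to [64x+21], [16x+5] and [4x+1]. *)
destruct (Z.eqb_spec (x mod 3) 0); [|destruct (Z.eqb_spec (x mod 3) 1)].
- exists 3%nat; split; [div_lia|]; change (4 ^ Z.of_nat 3) with 64; div_lia.
- exists 2%nat; split; [div_lia|]; change (4 ^ Z.of_nat 2) with 16; div_lia.
- exists 1%nat; split; [div_lia|]; change (4 ^ Z.of_nat 1) with 4; div_lia.
Qed.

Lemma companion_init_mod_12 (x : Z) : companion_init x mod 12 = 9.
Proof.
unfold companion_init; destruct (_ =? 0); [|destruct (_ =? 1)]; div_lia.
Qed.

(** Here [z = (3x+1)/2] selects the last branch, whose value is [4z+1 = 6x+3]. *)
Lemma companion_init_next_3_mod_4 (x z : Z) :
  x mod 4 = 3 -> next_odd x z -> companion_init z = 3 * (2 * x + 1).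
Proof.
intros Hx Hz.
assert (E : z = (3 * x + 1) / 2).
{ apply (next_odd_unique x); [exact Hz|split; [apply odd_mod_2; div_lia|]].
  exists 1%nat; change (2 ^ Z.of_nat 1) with 2; div_lia. }
unfold companion_init.
destruct (Z.eqb_spec (z mod 3) 0); [|destruct (Z.eqb_spec (z mod 3) 1)]; div_lia.
Qed.

(** Here [z = (3x+1)/4] selects the middle branch, whose value is [16z+5 = 12x+9]. *)
Lemma companion_init_next_1_mod_8 (x z : Z) :
  x mod 8 = 1 -> next_odd x z -> companion_init z = 3 * (4 * x + 3).
Proof.
intros Hx Hz.
assert (E : z = (3 * x + 1) / 4).
{ apply (next_odd_unique x); [exact Hz|split; [apply odd_mod_2; div_lia|]].
  exists 2%nat; change (2 ^ Z.of_nat 2) with 4; div_lia. }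
unfold companion_init.
destruct (Z.eqb_spec (z mod 3) 0); [|destruct (Z.eqb_spec (z mod 3) 1)]; div_lia.
Qed.

Lemma half_pred_odd (x : Z) : x mod 4 = 3 -> 12 * ((x - 1) / 2) + 9 = 3 * (2 * x + 1).
Proof. intros H; div_lia. Qed.

(** The clauses quantify over all decompositions of [x]. Left to right, one decomposition must be
    produced to extract [y]; right to left, every decomposition is shown to prescribe the same
    value. *)
Lemma companion_step_iff (x y z : Z) :
  Z.Odd x -> 1 < x -> next_odd x z ->
  (companion_step x y <-> y = companion_init z).
Proof.
intros Ho Hx Hz; split.
- intros (H3 & H1).
  destruct (odd_part_exists (x - 1) ltac:(lia)) as (k & N & HN & E).
  assert (E' : x = 2 ^ Z.of_nat k * N + 1) by lia.
  destruct (odd_part_pred_cases x N k Ho HN E') as [[-> Hm]|[[-> Hm]|[Hk Hm]]].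
  + rewrite (companion_init_next_3_mod_4 x z Hm Hz), (H3 Hm); now apply half_pred_odd.
  + destruct (jump_root_exists x ltac:(lia) Hm) as (P & HP & HJ & HNJ).
    destruct (H1 ltac:(clear - Hm; div_lia) 2%nat N (le_n _) HN E') as [_ H].
    destruct (H eq_refl P HP HJ HNJ) as [HP1 HPgt].
    (* The root [P] has the same next odd term as [x], so the two formulas above can be applied to
       [P] in place of [x]. *)
    assert (HPz := proj1 (next_odd_jump x P z HJ) Hz).
    assert (HPpos := jump_pos x P ltac:(lia) HP HJ).
    rewrite jump_from_odd_iff in HNJ.
    destruct (Z.eq_dec P 1) as [->|HPn].
    (* The root 1 is itself 1 mod 8, and [3(4*1+3) = 21]. *)
    * rewrite (companion_init_next_1_mod_8 1 z eq_refl HPz), HP1; reflexivity.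
    * destruct (odd_part_exists (P - 1) ltac:(lia)) as (r & q & Hq & F).
      assert (F' : P = 2 ^ Z.of_nat r * q + 1) by lia.
      destruct (HPgt ltac:(lia) r q Hq F') as [Hr1 Hr].
      destruct (odd_part_pred_cases P q r HP Hq F') as [[-> HPm]|[[-> HPm]|[Hk HPm]]].
      -- rewrite (companion_init_next_3_mod_4 P z HPm HPz), (Hr1 eq_refl); now apply half_pred_odd.
      -- contradiction.
      -- rewrite (companion_init_next_1_mod_8 P z HPm HPz), Hr; lia.
  + rewrite (companion_init_next_1_mod_8 x z Hm Hz).
    destruct (H1 ltac:(clear - Hm; div_lia) k N ltac:(lia) HN E') as [H _].
    rewrite (H Hk); lia.
- intros ->; split.
  + intros Hm; rewrite (companion_init_next_3_mod_4 x z Hm Hz); symmetry; now apply half_pred_odd.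
  + intros Hm4 k N Hk HN E.
    destruct (odd_part_pred_cases x N k Ho HN E) as [[-> Hm]|[[-> Hm]|[Hk' Hm]]];
      [div_lia| |split; [|lia]; rewrite (companion_init_next_1_mod_8 x z Hm Hz); lia].
    split; [lia|intros _ P HP HJ HNJ].
    assert (HPz := proj1 (next_odd_jump x P z HJ) Hz).
    rewrite jump_from_odd_iff in HNJ.
    split; [intros ->; now rewrite (companion_init_next_1_mod_8 1 z eq_refl HPz)|].
    intros HPgt r q Hq F.
    destruct (odd_part_pred_cases P q r HP Hq F) as [[-> HPm]|[[-> HPm]|[Hr HPm]]].
    * rewrite (companion_init_next_3_mod_4 P z HPm HPz).
      split; [intros _; symmetry; now apply half_pred_odd|lia].
    * contradiction.
    * rewrite (companion_init_next_1_mod_8 P z HPm HPz); lia.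
Qed.

(** * Consecutive odd terms of a Collatz sequence *)

Lemma collatz_even_run (A : Z) (n k : nat) :
  Z.odd (collatz A n) = true ->
  (forall j, (j < k)%nat -> Z.odd (collatz A (S n + j)) = false) ->
  3 * collatz A n + 1 = 2 ^ Z.of_nat k * collatz A (S n + k).
Proof.
intros Ho; induction k as [|k IH]; intros He.
- rewrite Nat.add_0_r, collatz_S; unfold collatz_step; rewrite Ho.
  change (2 ^ Z.of_nat 0) with 1; lia.
- rewrite IH by (intros j Hj; apply He; lia).
  assert (Hk := He k ltac:(lia)).
  rewrite Nat.add_succ_r, collatz_S, pow_succ_nat; unfold collatz_step; rewrite Hk.
  assert (Hm := Zmod_odd (collatz A (S n + k))); rewrite Hk in Hm.
  rewrite (Z.div_mod (collatz A (S n + k)) 2) at 1 by lia.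
  rewrite Hm; lia.
Qed.

Section OddTerms.

Variables (A : Z) (a : nat -> Z).
Hypothesis Ha : odd_terms A a.

Lemma odd_terms_odd (i : nat) : Z.Odd (a i).
Proof.
destruct Ha as (t & _ & Hr & Hv).
rewrite Hv; apply Hr; now exists i.
Qed.

Lemma odd_terms_pos (i : nat) : 0 < A -> 0 < a i.
Proof. destruct Ha as (t & _ & _ & ->); apply collatz_pos. Qed.

(** No odd term lies strictly between the indices [t i] and [t (S i)], because [t] is increasing and
    hits every odd index. After the step to [3x+1] there are thus only halvings, and their number is
    the exponent. *)
Lemma odd_terms_next (i : nat) : next_odd (a i) (a (S i)).
Proof.
split; [apply odd_terms_odd|].
assert (Ho := odd_terms_odd i).
destruct Ha as (t & Ht & Hr & Hv); rewrite !Hv in *.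
exists (t (S i) - S (t i))%nat.
assert (Hi := Ht i).
replace (t (S i)) with (S (t i) + (t (S i) - S (t i)))%nat at 2 by lia.
apply collatz_even_run; [now apply Z.odd_spec|].
intros j Hj; apply Bool.not_true_iff_false; intros Hodd.
apply Z.odd_spec, Hr in Hodd as [l Hl].
assert (Hmono : forall p q, (p <= q)%nat -> (t p <= t q)%nat).
{ intros p q Hpq; induction Hpq as [|q _ IH]; [lia|]; specialize (Ht q); lia. }
destruct (Nat.le_gt_cases l i) as [H|H];
  [specialize (Hmono l i H)|specialize (Hmono (S i) l H)]; lia.
Qed.

Lemma odd_terms_0 : Z.Odd A -> a 0%nat = A.
Proof.
intros Ho; destruct Ha as (t & Ht & Hr & Hv); rewrite Hv.
destruct (proj1 (Hr 0%nat) Ho) as [[|l] Hl]; [now rewrite Hl|].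
specialize (Ht l); lia.
Qed.

End OddTerms.

(** * Equivalence under jumps and the explicit companion sequence *)

Lemma collatz_equiv_jump (A B : Z) :
  0 < A -> 0 < B -> Z.Odd A -> Z.Odd B -> jump B A -> collatz_equiv A B.
Proof.
intros HA HB HoA HoB HJ.
destruct (odd_terms_exist A HA) as (a & Ha), (odd_terms_exist B HB) as (b & Hb).
exists a, b; split; [exact Ha|split; [exact Hb|]].
assert (Na := odd_terms_next A a Ha 0); rewrite (odd_terms_0 A a Ha HoA) in Na.
assert (Nb := odd_terms_next B b Hb 0); rewrite (odd_terms_0 B b Hb HoB) in Nb.
apply (next_odd_unique A); [exact Na|].
now apply (next_odd_jump B A _ HJ).
Qed.

(** Solves the recursion explicitly, which gives both the existence of [b] and a formula for each of
    its terms. *)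
Lemma companion_iff (A : Z) (a b : nat -> Z) :
  1 < A -> Z.Odd A -> odd_terms A a ->
  (companion A a b <-> forall i, b i = companion_init (a i)).
Proof.
intros HA HoA Ha.
assert (Hstep : forall i y, 1 < a i -> companion_step (a i) y <-> y = companion_init (a (S i))).
{ intros i y Hi; apply companion_step_iff; [apply (odd_terms_odd A a Ha)|exact Hi|].
  apply (odd_terms_next A a Ha). }
split.
- intros (H0 & H1 & HS) [|i].
  + now rewrite H0, (odd_terms_0 A a Ha HoA).
  + destruct (Z.eq_dec (a (S i)) 1) as [E|_]; [now rewrite (H1 _ E), E|].
    assert (Hpos := odd_terms_pos A a Ha i ltac:(lia)).
    destruct (Z.eq_dec (a i) 1) as [E|E].
    (* The recursive clause requires [a i > 1]; after a term 1, [3*1+1 = 2^2*1] shows that the next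
       odd term is 1 again, so the clause for terms equal to 1 applies. *)
    * assert (E' : a (S i) = 1).
      { apply (next_odd_unique (a i)); [apply (odd_terms_next A a Ha)|].
        rewrite E; split; [now exists 0|now exists 2%nat]. }
      now rewrite (H1 _ E'), E'.
    * apply Hstep; [lia|].
      assert (HSi := HS (S i) ltac:(lia)); rewrite Nat.sub_succ, Nat.sub_0_r in HSi.
      apply HSi; lia.
- intros Hb; split; [now rewrite Hb, (odd_terms_0 A a Ha HoA)|split].
  + intros i E; now rewrite Hb, E.
  + intros [|i] Hi; [lia|].
    rewrite Nat.sub_succ, Nat.sub_0_r; intros Hgt.
    now apply Hstep.
Qed.

Theorem theorem4p1 (A : Z) (a : nat -> Z)
  (HA : 1 < A) (HoddA : Z.Odd A) (Ha : odd_terms A a) :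
  (exists b : nat -> Z, companion A a b) /\
  forall b : nat -> Z, companion A a b ->
  forall i : nat,
    (Z.Odd (b i) /\ (3 | b i) /\ b i mod 12 = 9) /\
    collatz_equiv (a i) (b i) /\
    (1 < a i ->
     exists (k : nat) (n : Z),
       (1 <= k)%nat /\ Z.Odd n /\ a i = 2 ^ Z.of_nat k * n + 1 /\
       (k <> 2%nat ->
        (k = 1%nat -> b (S i) = 3 * (2 * a i + 1)) /\
        (k <> 1%nat -> b (S i) = 3 * (4 * a i + 3))) /\
       (k = 2%nat ->
        exists j : Z,
          Z.Odd j /\ jump (a i) j /\ ~ jump_from_odd j /\
          (1 < j ->
           exists (r : nat) (q : Z),
             (1 <= r)%nat /\ Z.Odd q /\ j = 2 ^ Z.of_nat r * q + 1 /\
             r <> 2%nat /\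
             (r = 1%nat -> b (S i) = 3 * (2 * j + 1)) /\
             (r <> 1%nat -> b (S i) = 3 * (4 * j + 3))))).
Proof.
split.
{ exists (fun i => companion_init (a i)); now apply companion_iff. }
intros b Hb i.
assert (Hbi := proj1 (companion_iff A a b HA HoddA Ha) Hb).
assert (Ho := odd_terms_odd A a Ha i).
assert (Hpos := odd_terms_pos A a Ha i ltac:(lia)).
assert (Hz := odd_terms_next A a Ha i).
assert (H12 := companion_init_mod_12 (a i)).
assert (Hob : Z.Odd (companion_init (a i))) by (apply odd_mod_2; div_lia).
assert (HJi := companion_init_jump (a i) Ho).
rewrite !Hbi; split; [|split].
- split; [exact Hob|split; [|exact H12]].
  exists (companion_init (a i) / 3); div_lia.
- apply collatz_equiv_jump; try assumption.
  apply jump_iff in HJi as (d & _ & E).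
  (* Positivity of [b i]: its triple plus 1 is [4^d (3 a_i + 1) > 0]. *)
  assert (0 < 4 ^ Z.of_nat d) by lia; nia.
- intros Hgt.
  destruct (odd_part_exists (a i - 1) ltac:(lia)) as (k & n & Hn & E).
  assert (E' : a i = 2 ^ Z.of_nat k * n + 1) by lia.
  assert (Hcases := odd_part_pred_cases (a i) n k Ho Hn E').
  exists k, n; split; [lia|split; [exact Hn|split; [exact E'|split]]].
  + intros Hk2; split; intros Hk.
    * apply companion_init_next_3_mod_4; [lia|exact Hz].
    * apply companion_init_next_1_mod_8; [lia|exact Hz].
  + intros Hk2.
    destruct (jump_root_exists (a i) ltac:(lia) ltac:(lia)) as (j & Hj & HJ & HNJ).
    exists j; split; [exact Hj|split; [exact HJ|split; [exact HNJ|]]].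
    intros Hj1.
    assert (Hjz := proj1 (next_odd_jump (a i) j _ HJ) Hz).
    rewrite jump_from_odd_iff in HNJ.
    destruct (odd_part_exists (j - 1) ltac:(lia)) as (r & q & Hq & F).
    assert (F' : j = 2 ^ Z.of_nat r * q + 1) by lia.
    assert (Hjcases := odd_part_pred_cases j q r Hj Hq F').
    (* Both [r >= 1] and [r <> 2] come from [Hjcases], since [HNJ] now says that [j] is not 5 mod
       8. *)
    exists r, q; split; [lia|split; [exact Hq|split; [exact F'|split; [lia|split]]]];
      intros Hr.
    * apply companion_init_next_3_mod_4; [lia|exact Hjz].
    * apply companion_init_next_1_mod_8; [lia|exact Hjz].
Qed.
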